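(* Consider the stochastic primal-dual hybrid gradient (SPDHG) method described in the context, run with step-sizes $\beta^{k+1} = \frac{1}{\sqrt{k+1}+L}$ and uniform averaging weights $\alpha^{k+1} = \frac{1}{t+1}$, $k=0,\dots,t$. Let $(y^*,x^* )$ be any saddle point of $\min_{x\in\mathcal{X}}\max_{y\in\mathcal{Y}} P(y,x)$. Then for every $t\ge 0$, $$0\le \mathbb{E}\left[P(y^*,\bar{x}^t) - P(\bar{y}^t,x^* )\right] \le \frac{D_y^2}{2s(t+1)} + \frac{L D_x^2}{2(t+1)} + \frac{D_x^2+2\lambda_{\max}(F^\top F)D_y^2+2\sigma^2}{\sqrt{t+1}},$$ i.e. $(\bar y^t,\bar x^t)$ converges to the saddle point at rate $O(1/\sqrt{t})$ in expectation.
   Context: Setting: $\mathcal{X}\subset\mathbb{R}^d$ is a nonempty convex compact set with diameter $D_x$ (so $\|x-x'\|\le D_x$ for all $x,x'\in\mathcal{X}$), $\mathcal{Y}\subset\mathbb{R}^l$ is a nonempty convex compact set with diameter $D_y$, $F\in\mathbb{R}^{l\times d}$, and $\lambda_{\max}(F^\top F)$ denotes the largest eigenvalue of $F^\top F$. The regularizer is $r(z)=\max_{y\in\mathcal{Y}}\langle y,z\rangle$. The loss is $l(x)=\mathbb{E}_\xi[l(x,\xi)]$, a convex, continuously differentiable function on $\mathcal{X}$ with $L$-Lipschitz gradient: $\|\nabla l(x_1)-\nabla l(x_2)\|\le L\|x_1-x_2\|$ for all $x_1,x_2\in\mathcal{X}$. The stochastic gradient $\nabla l(x,\xi)$ satisfies,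 for every $x\in\mathcal{X}$: $\mathbb{E}[\nabla l(x,\xi)]=\nabla l(x)$, $\mathbb{E}\|\nabla l(x,\xi)-\nabla l(x)\|^2\le\sigma^2$, and $\mathbb{E}\exp\left(\|\nabla l(x,\xi)-\nabla l(x)\|^2/\sigma^2\right)\le \exp(1)$, for a constant $\sigma>0$. The saddle function is $P(y,x)=l(x)+\langle y,Fx\rangle$ for $x\in\mathcal{X},y\in\mathcal{Y}$; a saddle point $(y^*,x^* )$ satisfies $P(y,x^* )\le P(y^*,x^* )\le P(y^*,x)$ for all $(y,x)\in\mathcal{Y}\times\mathcal{X}$ (assumed to exist). SPDHG: fix $s>0$, $x^0\in\mathcal{X}$, $y^0\in\mathcal{Y}$, and a sequence of step-sizes $\beta^{k+1}>0$. For $k=0,1,2,\dots$, draw a sample $\xi^{k+1}$ independently of the past (i.i.d. samples), and set $$y^{k+1}=\arg\max_{y\in\mathcal{Y}}\Big\{P(y,x^k)-\tfrac{1}{2s}\|y-y^k\|^2\Big\},\qquad x^{k+1}=\Pi_{\mathcal{X}}\Big[x^k-\beta^{k+1}\big(\nabla l(x^k,\xi^{k+1})+F^\top y^{k+1}\big)\Big],$$ where $\Pi_{\mathcal{X}}$ is Euclidean projection onto $\mathcal{X}$. Given weights $\alpha^{k+1}\ge0$ with $\sum_{k=0}^t\alpha^{k+1}=1$, the output after $t$ steps is $\bar x^t=\sum_{k=0}^t\alpha^{k+1}x^{k+1}$, $\bar y^t=\sum_{k=0}^t\alpha^{k+1}y^{k+1}$. *)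

(* Defs.v *)
From HB Require Import structures.
From mathcomp Require Import all_boot all_order all_algebra.
From mathcomp Require Import all_classical all_reals all_analysis.
Set Implicit Arguments. Unset Strict Implicit. Unset Printing Implicit Defensive.
Import Order.TTheory GRing.Theory Num.Theory numFieldNormedType.Exports.
Local Open Scope ring_scope.
Local Open Scope classical_set_scope.

Definition dotv {R : realType} {n : nat} (u v : 'cV[R]_n) : R :=
  \sum_(i < n) u i 0 * v i 0.

Definition enorm {R : realType} {n : nat} (u : 'cV[R]_n) : R :=
  Num.sqrt (dotv u u).

Definition convex_set_ {R : realType} {n : nat} (A : set 'cV[R]_n) : Prop :=
  forall x y, A x -> A y -> forall th : R, 0 <= th <= 1 ->
    A (th *: x + (1 - th) *: y).

Definition convex_on {R : realType} {n : nat} (A : set 'cV[R]_n)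
  (f : 'cV[R]_n -> R) : Prop :=
  forall x y, A x -> A y -> forall th : R, 0 <= th <= 1 ->
    f (th *: x + (1 - th) *: y) <= th * f x + (1 - th) * f y.

Definition Psad {R : realType} {d l : nat} (loss : 'cV[R]_d -> R)
  (F : 'M[R]_(l, d)) (y : 'cV[R]_l) (x : 'cV[R]_d) : R :=
  loss x + dotv y (F *m x).

Definition is_lambda_max {R : realType} {n : nat} (M : 'M[R]_n) (lam : R) : Prop :=
  eigenvalue M lam /\ forall a, eigenvalue M a -> a <= lam.

Definition measurable_vec {R : realType} {n : nat} {dT : measure_display}
  {T : measurableType dT} (X : T -> 'cV[R]_n) : Prop :=
  forall i : 'I_n, measurable_fun setT (fun w => X w i 0).

(* Joint (Borel x Xi) measurability of the stochastic gradient map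
   (x, xi) |-> G x xi, expressed as: composing with any measurable pair of
   maps (X, Z) yields a measurable map. *)
Definition jointly_measurable {R : realType} {n : nat} {dX : measure_display}
  {Xi : measurableType dX} (G : 'cV[R]_n -> Xi -> 'cV[R]_n) : Prop :=
  forall (dT : measure_display) (T : measurableType dT)
    (X : T -> 'cV[R]_n) (Z : T -> Xi),
    measurable_vec X -> measurable_fun setT Z ->
    measurable_vec (fun w => G (X w) (Z w)).

Definition mutually_independent {R : realType} {dT : measure_display}
  {T : measurableType dT} (P : probability T R) {dX : measure_display}
  {Xi : measurableType dX} (xi : nat -> T -> Xi) : Prop :=
  (forall k, measurable_fun setT (xi k)) /\
  forall (s : seq nat) (B : nat -> set Xi), uniq s ->
    (forall k, measurable (B k)) ->
    P (\big[setI/setT]_(k <- s) (xi k @^-1` B k)) =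
    (\prod_(k <- s) P (xi k @^-1` B k))%E.

Definition identically_distributed {R : realType} {dT : measure_display}
  {T : measurableType dT} (P : probability T R) {dX : measure_display}
  {Xi : measurableType dX} (xi : nat -> T -> Xi) (mu : probability Xi R) : Prop :=
  forall k (A : set Xi), measurable A -> P (xi k @^-1` A) = mu A.

(* Step sizes beta^{k+1} = 1 / (sqrt(k+1) + L). *)
Definition beta_step {R : realType} (L : R) (k : nat) : R :=
  1 / (Num.sqrt (k.+1)%:R + L).

Definition avg {R : realType} {n : nat} (v : nat -> 'cV[R]_n) (t : nat) : 'cV[R]_n :=
  (t.+1%:R)^-1 *: \sum_(k < t.+1) v k.+1.

(* Main.v *)
(* One step of the method is analysed through the variational inequalities of the two
   Euclidean projections, the descent lemma and the gradient inequality for [loss]; since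
   [1 / beta_k = sqrt (k+1) + L], the [L/2 |x' - x|^2] of the descent lemma is absorbed and
   the remaining [- sqrt (k+1) / 2 |x' - x|^2] pays, by Young's inequality, for the gradient
   noise and for the lag [<ys - y', F (x' - x)>], leaving [(|delta|^2 + lam Dy^2) / sqrt (k+1)].
   Summing telescopes the distances, and [sum 1 / sqrt (k+1) <= 2 sqrt (t+1)].
   The cross terms [<delta_k, x_k - xs>] have mean zero because [x_k] is measurable for the
   sigma-algebra generated by [xi_1, ..., xi_k]: the joint law of (that sigma-algebra,
   [xi_(k+1)]) is a product measure and Fubini applies. *)
Require Import Defs.
From HB Require Import structures.
From mathcomp Require Import all_boot all_order all_algebra.
From mathcomp Require Import all_classical all_reals all_analysis.
From mathcomp Require Import measurable_realfun.
From mathcomp Require Import ring lra.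
Set Implicit Arguments.
Unset Strict Implicit.
Unset Printing Implicit Defensive.
Import Order.TTheory GRing.Theory Num.Theory numFieldNormedType.Exports.
Local Open Scope ring_scope.
Local Open Scope classical_set_scope.

(** * Euclidean geometry and projections *)

Lemma dotvC {R : realType} {n : nat} (u v : 'cV[R]_n) : dotv u v = dotv v u.
Proof. by apply: eq_bigr => i _; rewrite mulrC. Qed.

Lemma dotvDl {R : realType} {n : nat} (u v w : 'cV[R]_n) :
  dotv (u + v) w = dotv u w + dotv v w.
Proof. by rewrite -big_split; apply: eq_bigr => i _; rewrite mxE mulrDl. Qed.

Lemma dotvZl {R : realType} {n : nat} (a : R) (u w : 'cV[R]_n) :
  dotv (a *: u) w = a * dotv u w.
Proof. by rewrite mulr_sumr; apply: eq_bigr => i _; rewrite mxE mulrA. Qed.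

Lemma dotvNl {R : realType} {n : nat} (u w : 'cV[R]_n) :
  dotv (- u) w = - dotv u w.
Proof. by rewrite -scaleN1r dotvZl mulN1r. Qed.

Lemma dotvDr {R : realType} {n : nat} (u v w : 'cV[R]_n) :
  dotv w (u + v) = dotv w u + dotv w v.
Proof. by rewrite !(dotvC w) dotvDl. Qed.

Lemma dotvZr {R : realType} {n : nat} (a : R) (u w : 'cV[R]_n) :
  dotv w (a *: u) = a * dotv w u.
Proof. by rewrite !(dotvC w) dotvZl. Qed.

Lemma dotvNr {R : realType} {n : nat} (u w : 'cV[R]_n) :
  dotv w (- u) = - dotv w u.
Proof. by rewrite !(dotvC w) dotvNl. Qed.

Definition dotvE := (@dotvDl, @dotvDr, @dotvNl, @dotvNr, @dotvZl, @dotvZr).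

Lemma dotv_sumr {R : realType} {n : nat} (I : Type) (r : seq I) (f : I -> 'cV[R]_n)
  (u : 'cV[R]_n) : dotv u (\sum_(i <- r) f i) = \sum_(i <- r) dotv u (f i).
Proof.
elim/big_rec2: _ => [|i y1 y2 _ <-]; last by rewrite dotvDr.
by rewrite -(scale0r 0) dotvZr mul0r.
Qed.

Lemma dotv_trmx {R : realType} {m n : nat} (A : 'M[R]_(m, n)) (u : 'cV[R]_m)
  (v : 'cV[R]_n) : dotv (A^T *m u) v = dotv u (A *m v).
Proof.
rewrite /dotv; under eq_bigr do rewrite mxE mulr_suml.
rewrite exchange_big; apply: eq_bigr => i _.
rewrite mxE mulr_sumr; apply: eq_bigr => j _; rewrite mxE; ring.
Qed.

Lemma dotv_ge0 {R : realType} {n : nat} (u : 'cV[R]_n) : 0 <= dotv u u.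
Proof. by apply: sumr_ge0 => i _; rewrite -expr2 sqr_ge0. Qed.

Lemma dotv_eq0 {R : realType} {n : nat} (u : 'cV[R]_n) : (dotv u u == 0) = (u == 0).
Proof.
apply/eqP/eqP => [|->]; last by rewrite /dotv big1 // => i _; rewrite mxE mul0r.
move/eqP; rewrite psumr_eq0 => [/allP h|i _]; last by rewrite -expr2 sqr_ge0.
apply/matrixP => i j; rewrite ord1 mxE; apply/eqP.
by have := h i (mem_index_enum _); rewrite mulf_eq0 orbb.
Qed.

Lemma enorm_sqr {R : realType} {n : nat} (u : 'cV[R]_n) : enorm u ^+ 2 = dotv u u.
Proof. by rewrite sqr_sqrtr // dotv_ge0. Qed.

Lemma enorm_ge0 {R : realType} {n : nat} (u : 'cV[R]_n) : 0 <= enorm u.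
Proof. exact: sqrtr_ge0. Qed.

Lemma dotv_le_enormM {R : realType} {n : nat} (u v : 'cV[R]_n) :
  dotv u v <= enorm u * enorm v.
Proof.
have [->|v0] := eqVneq v 0.
  by rewrite -(scale0r 0) dotvZr mul0r mulr_ge0 ?enorm_ge0.
have hv : 0 < dotv v v by rewrite lt_def dotv_eq0 v0 dotv_ge0.
have := dotv_ge0 (dotv v v *: u - dotv u v *: v).
rewrite !dotvE (dotvC v u) => h.
have h2 : dotv u v ^+ 2 <= dotv u u * dotv v v.
  rewrite -(ler_pM2l hv) -subr_ge0; apply: le_trans h _.
  by rewrite le_eqVlt; apply/orP; left; apply/eqP; ring.
apply: le_trans (ler_norm _) _.
rewrite -(ler_pXn2r (n := 2)) // ?nnegrE ?mulr_ge0 ?enorm_ge0 //.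
by rewrite exprMn !enorm_sqr real_normK // num_real.
Qed.

Lemma enorm_ler_sqr {R : realType} {m n : nat} (u : 'cV[R]_m) (v : 'cV[R]_n) :
  (enorm u <= enorm v) = (dotv u u <= dotv v v).
Proof. by rewrite ler_sqrt // dotv_ge0. Qed.

(** Divide by [th] and let it tend to 0. This is the common form of the first-order arguments below:
    a perturbation of size [th] gains [th * a] at a cost of order [th ^+ 2]. *)
Lemma le0_of_quadratic {R : realType} (a b : R) :
  (forall th, 0 < th <= 1 -> th * a <= th ^+ 2 * b) -> a <= 0.
Proof.
move=> h; rewrite leNgt; apply/negP => a0.
have b0 : 0 < a + `|b| by rewrite ltr_pwDl.
(* This [th] is chosen so that th (a + |b|) = a / 2, hence th b < a / 2 < a, against the
   hypothesis. *)
have /h : 0 < a / (2 * (a + `|b|)) <= 1.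
  rewrite divr_gt0 ?mulr_gt0 //= ler_pdivrMr ?mulr_gt0 // mul1r.
  have := normr_ge0 b; lra.
set th := a / _; have th0 : 0 < th by rewrite divr_gt0 ?mulr_gt0.
have e : th * (a + `|b|) = a / 2.
  by rewrite /th; field; rewrite gt_eqF.
rewrite expr2 -mulrA ler_pM2l // => {}h.
have := ler_wpM2l (ltW th0) (ler_norm b).
have := mulr_gt0 th0 a0; lra.
Qed.

(** Moving from [p] towards [z] stays in [A], and the squared distance to [v] is then quadratic in
    [th] with linear coefficient -2 <z - p, v - p>, which minimality of [p] forces to be
    nonnegative. *)
Lemma projection_variational {R : realType} {n : nat} (A : set 'cV[R]_n)
  (p v z : 'cV[R]_n) : convex_set_ A -> A p ->
  (forall z, A z -> enorm (p - v) <= enorm (z - v)) -> A z ->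
  dotv (z - p) (v - p) <= 0.
Proof.
move=> cA Ap hp Az; rewrite -(pmulr_rle0 _ (ltr0n _ 2)).
apply: (@le0_of_quadratic _ _ (dotv (z - p) (z - p))) => th /andP[th0 th1].
have /hp : A (th *: z + (1 - th) *: p) by apply: cA => //; rewrite ltW.
have -> : th *: z + (1 - th) *: p - v = (p - v) + th *: (z - p).
  by apply/matrixP => i j; rewrite !mxE; ring.
have -> : v - p = - (p - v) by rewrite opprB.
rewrite enorm_ler_sqr; move: (p - v) (z - p) => u w.
rewrite !dotvE (dotvC w u); lra.
Qed.

(** Each projection is tested against the other one; the sum gives |p1 - p2|^2 <= <p1 - p2, v1 -
    v2>. It serves to make the iterates measurable, as Lipschitz images of measurable vectors. *)
Lemma projection_nonexpansive {R : realType} {n : nat} (A : set 'cV[R]_n)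
  (p1 p2 v1 v2 : 'cV[R]_n) : convex_set_ A -> A p1 -> A p2 ->
  (forall z, A z -> enorm (p1 - v1) <= enorm (z - v1)) ->
  (forall z, A z -> enorm (p2 - v2) <= enorm (z - v2)) ->
  dotv (p1 - p2) (p1 - p2) <= dotv (v1 - v2) (v1 - v2).
Proof.
move=> cA A1 A2 h1 h2.
have := projection_variational cA A1 h1 A2.
have := projection_variational cA A2 h2 A1.
have := dotv_ge0 ((p1 - p2) - (v1 - v2)).
rewrite !dotvE (dotvC v1 p1) (dotvC v2 p1) (dotvC v1 p2) (dotvC v2 p2)
  (dotvC p2 p1) (dotvC v2 v1); lra.
Qed.

(* Completing the square turns the proximal ascent step into the Euclidean projection of
   [y + s F x] onto [Y]. *)
Lemma prox_argmax_projection {R : realType} {d l : nat} (loss : 'cV[R]_d -> R)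
  (F : 'M[R]_(l, d)) (s : R) (x : 'cV[R]_d) (y y' z : 'cV[R]_l) : 0 < s ->
  Psad loss F z x - (2 * s)^-1 * enorm (z - y) ^+ 2
    <= Psad loss F y' x - (2 * s)^-1 * enorm (y' - y) ^+ 2 ->
  enorm (y' - (y + s *: (F *m x))) <= enorm (z - (y + s *: (F *m x))).
Proof.
move=> s0; rewrite /Psad enorm_ler_sqr !enorm_sqr; move: (F *m x) => f.
have s2 : 0 < 2 * s by rewrite mulr_gt0.
rewrite -(ler_pM2l s2) !mulrBr !mulrA divff ?gt_eqF // !mul1r.
rewrite !dotvE (dotvC y z) (dotvC y y') (dotvC f z) (dotvC f y') (dotvC f y); lra.
Qed.

(** * Uniform averages and scalar sums *)

Lemma invr_natS {R : realType} (t : nat) :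
  t.+1%:R^-1 = 1 - t%:R / t.+1%:R :> R.
Proof.
have h : t.+1%:R != 0 :> R by rewrite pnatr_eq0.
by apply: (mulIf h); rewrite mulrBl mulVf // divfK // mul1r -natrB // subSnn.
Qed.

(** A running average is a two-point convex combination, so the two-point definitions of convexity
    extend to averages by induction. *)
Lemma avgS {R : realType} {n : nat} (v : nat -> 'cV[R]_n) (t : nat) :
  avg v t.+1 = (t.+1%:R / t.+2%:R) *: avg v t + (1 - t.+1%:R / t.+2%:R) *: v t.+2.
Proof.
rewrite /avg big_ord_recr /= scalerDr scalerA mulrAC divff ?mul1r ?pnatr_eq0 //.
by rewrite -(invr_natS t.+1).
Qed.

Lemma convex_set_avg {R : realType} {n : nat} (A : set 'cV[R]_n)
  (v : nat -> 'cV[R]_n) : convex_set_ A -> (forall k, A (v k.+1)) ->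
  forall t, A (avg v t).
Proof.
move=> cA hv; elim=> [|t IH].
  by rewrite /avg big_ord_recl big_ord0 addr0 invr1 scale1r; exact: hv.
rewrite avgS; apply: cA => //.
by rewrite divr_ge0 //= ler_pdivrMr // mul1r ler_nat.
Qed.

Lemma convex_on_avg {R : realType} {n : nat} (A : set 'cV[R]_n) (f : 'cV[R]_n -> R)
  (v : nat -> 'cV[R]_n) : convex_set_ A -> convex_on A f -> (forall k, A (v k.+1)) ->
  forall t, f (avg v t) <= t.+1%:R^-1 * \sum_(k < t.+1) f (v k.+1).
Proof.
move=> cA cf hv; elim=> [|t IH].
  by rewrite /avg !big_ord_recl !big_ord0 !addr0 invr1 scale1r mul1r.
rewrite avgS; apply: le_trans (cf _ _ _ _ _ _) _ => //.
- exact: convex_set_avg.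
- by rewrite divr_ge0 //= ler_pdivrMr // mul1r ler_nat.
rewrite big_ord_recr /= mulrDr lerD //.
  have e : t.+2%:R^-1 = t.+1%:R / t.+2%:R * t.+1%:R^-1 :> R.
    by rewrite mulrAC divff ?mul1r // pnatr_eq0.
  by rewrite [in leRHS]e -[leRHS]mulrA ler_wpM2l // divr_ge0.
by rewrite -(invr_natS t.+1).
Qed.

(** Summation by parts: each increment of the nondecreasing weights multiplies a term of [a], at
    most [M], and these increments telescope to [b t]. *)
Lemma telescope_weighted {R : realType} (a b : nat -> R) (M : R) (t : nat) :
  (forall k, 0 <= b k <= b k.+1) -> (forall k, 0 <= a k <= M) ->
  \sum_(k < t.+1) b k * (a k - a k.+1) <= b t * M.
Proof.
move=> hb ha.
(* The last term - b t * a t.+1 is kept so that the induction closes. *)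
suff : \sum_(k < t.+1) b k * (a k - a k.+1) <= b t * (M - a t.+1).
  move=> h; apply: le_trans h _; rewrite ler_wpM2l //; first by case/andP: (hb t).
  by case/andP: (ha t.+1) => *; lra.
elim: t => [|t IH]; rewrite big_ord_recr /=.
  by rewrite big_ord0 add0r ler_wpM2l ?(andP (hb 0)).1 // lerB // (andP (ha 0)).2.
apply: le_trans (lerD IH (lexx _)) _.
have /andP[b0 b1] := hb t; have /andP[a0 aM] := ha t.+1; nra.
Qed.

(** With a = sqrt t and b = sqrt (t+1), the increment bound 1 / b <= 2 (b - a) amounts to 2 a b <=
    a^2 + b^2, because b^2 = a^2 + 1. *)
Lemma sum_invsqrt_le {R : realType} (t : nat) :
  \sum_(k < t) (Num.sqrt k.+1%:R)^-1 <= 2 * Num.sqrt t%:R :> R.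
Proof.
elim: t => [|t IH]; first by rewrite big_ord0 sqrtr0 mulr0.
rewrite big_ord_recr /=; apply: le_trans (lerD IH (lexx _)) _.
have b0 : 0 < Num.sqrt t.+1%:R :> R by rewrite sqrtr_gt0 ltr0n.
have bE : Num.sqrt t.+1%:R ^+ 2 = t.+1%:R :> R by rewrite sqr_sqrtr.
have aE : Num.sqrt t%:R ^+ 2 = t%:R :> R by rewrite sqr_sqrtr.
have a0 : 0 <= Num.sqrt t%:R :> R by rewrite sqrtr_ge0.
rewrite -(ler_pM2r b0) mulrDl mulVf ?gt_eqF //.
move: bE aE a0 b0; rewrite -natr1; move: (Num.sqrt _) (Num.sqrt _) => a b *; nra.
Qed.

(** * Largest eigenvalue as a Rayleigh bound *)

(** Row vectors are used here because [rV_compact] and [eigenvalue] speak of rows. *)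
Lemma continuous_quadratic_form {R : realType} {n : nat} (M : 'M[R]_n) :
  continuous (fun u : 'rV[R]_n => dotv u^T (M *m u^T)).
Proof.
apply: continuous_big => [|i _]; first exact: add_continuous.
move=> u; apply: (@continuousM _ _ (fun u : 'rV[R]_n => u^T i 0)
    (fun u : 'rV[R]_n => (M *m u^T) i 0)).
  have -> : (fun u : 'rV[R]_n => u^T i 0) = (fun u => u 0 i).
    by apply/funext => v; rewrite mxE.
  exact: coord_continuous.
have -> : (fun u : 'rV[R]_n => (M *m u^T) i 0) =
          (fun u => \sum_j M i j * u 0 j).
  by apply/funext => v; rewrite mxE; apply: eq_bigr => j _; rewrite mxE.
move: u; apply: continuous_big => [|j _]; first exact: add_continuous.
move=> u; apply: (@continuousM _ _ (cst (M i j)) (fun u : 'rV[R]_n => u 0 j)).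
  exact: cst_continuous.
exact: coord_continuous.
Qed.

(** The sphere is a closed subset of the cube [-1, 1]^n. *)
Lemma compact_unit_sphere {R : realType} {n : nat} :
  compact [set u : 'rV[R]_n | dotv u^T u^T = 1].
Proof.
apply: (@subclosed_compact _ _
    [set u : 'rV[R]_n | forall i, `[(-1 : R), 1] (u 0 i)]).
- have cq : continuous (fun u : 'rV[R]_n => dotv u^T u^T).
    by have := @continuous_quadratic_form R n 1%:M; under eq_fun do rewrite mul1mx.
  apply: (@preimage_closed _ _ (fun u : 'rV[R]_n => dotv u^T u^T) [set x | x = 1]).
    by move=> u _; exact: cq.
  exact: closed_eq.
- by apply: (@rV_compact R n (fun=> `[(-1 : R), 1])) => i; exact: segment_compact.
- move=> u /= u1 i; rewrite /= in_itv /= -ler_norml.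
  rewrite -(ler_pXn2r (n := 2)) // ?nnegrE // expr1n real_normK ?num_real //.
  rewrite -[leRHS]u1 /dotv (bigD1 i) //= !mxE -expr2 lerDl sumr_ge0 // => j _.
  by rewrite !mxE -expr2 sqr_ge0.
Qed.

(** The quadratic form attains a maximum [m] on the unit sphere; [m] is an eigenvalue, hence at most
    [lam], and homogeneity gives the bound for every [v]. *)
Lemma rayleigh_le {R : realType} {n : nat} (M : 'M[R]_n) (lam : R) (v : 'cV[R]_n) :
  M^T = M -> is_lambda_max M lam -> dotv v (M *m v) <= lam * dotv v v.
Proof.
move=> symM [_ hlam].
have [->|v0] := eqVneq v 0.
  by rewrite mulmx0 (eqP (etrans (dotv_eq0 0) (eqxx _))) mulr0.
have nsph (w : 'cV[R]_n) : w != 0 -> dotv ((enorm w)^-1 *: w) ((enorm w)^-1 *: w) = 1.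
  move=> w0; rewrite dotvZl dotvZr -enorm_sqr expr2 mulrA.
  have : enorm w != 0 by rewrite sqrtr_eq0 -ltNge lt_def dotv_eq0 w0 dotv_ge0.
  by move=> h; rewrite mulrA -invfM -mulrA mulVf // mulf_neq0.
have [] := @compact_EVT_max _ R (fun u : 'rV[R]_n => dotv u^T (M *m u^T)) _ _
  (@compact_unit_sphere R n) (continuous_subspaceT (@continuous_quadratic_form R n M)).
  by exists ((enorm v)^-1 *: v)^T; rewrite /= trmxK nsph.
move=> c; rewrite inE /=; set m := dotv _ (M *m _) => c1 hc.
have hm (w : 'cV[R]_n) : dotv w (M *m w) <= m * dotv w w.
  have [->|w0] := eqVneq w 0.
    by rewrite mulmx0 (eqP (etrans (dotv_eq0 0) (eqxx _))) mulr0.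
  have := hc ((enorm w)^-1 *: w)^T; rewrite inE /= trmxK nsph // => /(_ erefl).
  rewrite -scalemxAr dotvZl dotvZr mulrA -invfM -expr2 enorm_sqr.
  by rewrite mulrC ler_pdivrMr // lt_def dotv_eq0 w0 dotv_ge0.
(* The maximizer [c] of the Rayleigh quotient is an eigenvector: [m I - M] is positive
   semidefinite and vanishes at [c]. *)
have [e eE] : exists e, e = m *: c^T - M *m c^T by eexists.
suff e0 : e = 0.
  apply: le_trans (hm v) _; rewrite ler_wpM2r ?dotv_ge0 // hlam //.
  apply/eigenvalueP; exists c.
    by apply: trmx_inj; rewrite trmx_mul symM linearZ /=; apply/esym/eqP;
      rewrite -subr_eq0 -eE e0.
  apply/eqP => c0; move: c1; rewrite c0 trmx0 (eqP (etrans (dotv_eq0 0) (eqxx _))).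
  by move/eqP; rewrite eq_sym oner_eq0.
apply/eqP; rewrite -dotv_eq0 eq_le dotv_ge0 andbT -(pmulr_rle0 _ (ltr0n _ 2)).
(* The maximizer is perturbed along the residual [e] itself: the gain is 2 th |e|^2 to first order,
   which maximality excludes unless e = 0. *)
apply: (@le0_of_quadratic _ _ (m * dotv e e - dotv e (M *m e))) => th _.
have := hm (c^T - th *: e).
rewrite mulmxBr -scalemxAr !dotvE c1.
have -> : dotv e c^T = dotv c^T e by rewrite dotvC.
have -> : dotv c^T (M *m e) = dotv e (M *m c^T).
  by rewrite -dotv_trmx symM dotvC.
have -> : dotv c^T (M *m c^T) = m by [].
have -> : dotv e e = m * dotv c^T e - dotv e (M *m c^T).
  by rewrite {2}eE dotvDr dotvNr dotvZr (dotvC e c^T).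
lra.
Qed.

Lemma opnorm_sqr_le {R : realType} {l d : nat} (F : 'M[R]_(l, d)) (lam : R)
  (v : 'cV[R]_d) : is_lambda_max (F^T *m F) lam ->
  dotv (F *m v) (F *m v) <= lam * dotv v v.
Proof.
move=> /(rayleigh_le v); rewrite trmx_mul trmxK => /(_ erefl).
by rewrite -mulmxA dotvC dotv_trmx.
Qed.

(** The eigenvector provides a nonzero [v] with 0 <= |F v|^2 <= lam |v|^2. *)
Lemma lambda_max_ge0 {R : realType} {l d : nat} (F : 'M[R]_(l, d)) (lam : R) :
  is_lambda_max (F^T *m F) lam -> 0 <= lam.
Proof.
move=> hlam; case: (hlam) => /eigenvalueP[v _ v0] _.
have hv : 0 < dotv v^T v^T.
  by rewrite lt_def dotv_eq0 dotv_ge0 andbT; apply: contra v0 => /eqP h;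
    rewrite -(trmxK v) h trmx0.
by rewrite -(pmulr_lge0 _ hv); apply: le_trans (opnorm_sqr_le v^T hlam); exact: dotv_ge0.
Qed.

(** * Smooth convex functions and the pathwise gap bound *)

Lemma is_derive_along_line {R : realType} {n : nat} (f : 'cV[R]_n -> R)
  (x h g : 'cV[R]_n) (t : R) :
  differentiable f (x + t *: h) ->
  (forall v, 'd f (x + t *: h) v = dotv g v) ->
  is_derive t 1 (fun t => f (x + t *: h)) (dotv g h).
Proof.
move=> df hg.
have E : (fun k : R => k^-1 *: (((fun t => f (x + t *: h)) \o shift t) (k *: 1)
      - f (x + t *: h))) =
  (fun k : R => k^-1 *: ((f \o shift (x + t *: h)) (k *: h) - f (x + t *: h))).
  apply/funext => k /=; congr (_ *: (f _ - _)).
  by rewrite scaler1 scalerDl addrCA.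
have dv : derivable f (x + t *: h) h by exact: diff_derivable.
by split; [rewrite /derivable E|rewrite /derive E -/(derive f _ h) deriveE].
Qed.

(** The mean value theorem is applied to u |-> f (x + u (z - x)) - a u - b u^2. The free [a] and [b]
    let one statement serve both the descent lemma, where the correction is the quadratic model, and
    the gradient inequality, where it is zero. *)
Lemma mvt_along_line {R : realType} {n : nat} (X : set 'cV[R]_n) (f : 'cV[R]_n -> R)
  (gradf : 'cV[R]_n -> 'cV[R]_n) (x z : 'cV[R]_n) (t a b : R) :
  convex_set_ X ->
  (forall x, X x -> differentiable f x /\ forall v, 'd f x v = dotv (gradf x) v) ->
  X x -> X z -> 0 < t <= 1 ->
  exists2 c, 0 < c < t &
    f (x + t *: (z - x)) - t * a - t ^+ 2 * b - f x =
    (dotv (gradf (x + c *: (z - x))) (z - x) - a - 2 * c * b) * t.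
Proof.
move=> cX hf Xx Xz /andP[t0 t1].
have Xl (u : R) : 0 <= u <= 1 -> X (x + u *: (z - x)).
  move=> hu; have := cX _ _ Xz Xx _ hu; congr X.
  by apply/matrixP => i j; rewrite !mxE; ring.
pose p : {poly R} := a *: 'X + b *: 'X^2.
pose psi (u : R) := f (x + u *: (z - x)) - p.[u].
have D (u : R) : 0 <= u <= 1 -> is_derive u 1 psi
    (dotv (gradf (x + u *: (z - x))) (z - x) - a - 2 * u * b).
  move=> /Xl /hf[d1 d2].
  have h1 := is_derive_along_line d1 d2.
  have h2 := is_derive_poly p u.
  apply: is_derive_eq.
  rewrite /p derivD !derivZ derivX derivXn !(hornerD, hornerZ, hornerC, hornerX, hornerMn) /=.
  ring.
have [|c|c] := @MVT R psi (fun u => dotv (gradf (x + u *: (z - x))) (z - x) - a - 2 * u * b)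
  0 t t0.
- by move=> u; rewrite in_itv /= => /andP[u0 u1]; apply: D; lra.
- apply: derivable_within_continuous => u; rewrite in_itv /= => /andP[u0 u1].
  by have [|//] := D u; lra.
rewrite in_itv /= => ct; rewrite subr0 => e; exists c => //.
rewrite -e /psi /p !hornerE /= scale0r addr0; ring.
Qed.

Lemma enormZ {R : realType} {n : nat} (c : R) (u : 'cV[R]_n) :
  0 <= c -> enorm (c *: u) = c * enorm u.
Proof.
by move=> c0; rewrite /enorm dotvZl dotvZr mulrA -expr2 sqrtrM ?sqr_ge0 // sqrtr_sqr ger0_norm.
Qed.

Lemma enormB {R : realType} {n : nat} (u v : 'cV[R]_n) : enorm (u - v) = enorm (v - u).
Proof. by rewrite /enorm -opprB dotvNl dotvNr opprK. Qed.

Lemma lipschitz_grad_line {R : realType} {n : nat} (X : set 'cV[R]_n)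
  (gradf : 'cV[R]_n -> 'cV[R]_n) (L : R) (x z : 'cV[R]_n) (c : R) :
  convex_set_ X ->
  (forall x1 x2, X x1 -> X x2 -> enorm (gradf x1 - gradf x2) <= L * enorm (x1 - x2)) ->
  X x -> X z -> 0 <= c <= 1 ->
  `|dotv (gradf (x + c *: (z - x))) (z - x) - dotv (gradf x) (z - x)|
    <= L * c * enorm (z - x) ^+ 2.
Proof.
move=> cX hL Xx Xz hc.
have Xc : X (x + c *: (z - x)).
  have := cX _ _ Xz Xx _ hc; congr X.
  by apply/matrixP => i j; rewrite !mxE; ring.
have := hL _ _ Xc Xx; rewrite [x + _ - x]addrC addKr enormZ ?(andP hc).1 // => h.
(* Stated for any [u], so that the gradient difference and its opposite give the two sides of the
   absolute value. *)
have K (u : 'cV[R]_n) : enorm u <= L * (c * enorm (z - x)) ->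
    dotv u (z - x) <= L * c * enorm (z - x) ^+ 2.
  move=> hu; apply: le_trans (dotv_le_enormM _ _) _.
  by rewrite expr2 !mulrA ler_wpM2r ?enorm_ge0 // -mulrA.
rewrite -dotvNl -dotvDl ler_norml K // andbT lerNl -dotvNl K //.
by rewrite opprB [leLHS]enormB.
Qed.

(** With b = L / 2 |z - x|^2, the derivative of the corrected function at the intermediate [c] is <=
    0, since the gradient varies by at most L c |z - x|^2 = 2 c b along the segment. No integral is
    required. *)
Lemma descent_lemma {R : realType} {n : nat} (X : set 'cV[R]_n) (f : 'cV[R]_n -> R)
  (gradf : 'cV[R]_n -> 'cV[R]_n) (L : R) (x z : 'cV[R]_n) :
  convex_set_ X ->
  (forall x, X x -> differentiable f x /\ forall v, 'd f x v = dotv (gradf x) v) ->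
  (forall x1 x2, X x1 -> X x2 -> enorm (gradf x1 - gradf x2) <= L * enorm (x1 - x2)) ->
  X x -> X z ->
  f z <= f x + dotv (gradf x) (z - x) + L / 2 * enorm (z - x) ^+ 2.
Proof.
move=> cX hf hL Xx Xz.
have [|c /andP[c0 c1]] := @mvt_along_line _ _ X f gradf x z 1 (dotv (gradf x) (z - x))
  (L / 2 * enorm (z - x) ^+ 2) cX hf Xx Xz; first by rewrite ltr01 lexx.
rewrite scale1r addrCA subrr addr0.
have := @lipschitz_grad_line _ _ X gradf L x z c cX hL Xx Xz.
have hc : 0 <= c <= 1 by lra.
by move=> /(_ hc); rewrite ler_norml => /andP[_]; lra.
Qed.

(** Convexity bounds f (x + t (z - x)) - f x by t (f z - f x), and the mean value theorem writes it
    as t times a slope at [c < t]. Moving that slope back to [x] costs t^2 L |z - x|^2, negligible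
    as [t] tends to 0. *)
Lemma convex_grad_ineq {R : realType} {n : nat} (X : set 'cV[R]_n) (f : 'cV[R]_n -> R)
  (gradf : 'cV[R]_n -> 'cV[R]_n) (L : R) (x z : 'cV[R]_n) :
  convex_set_ X -> convex_on X f ->
  (forall x, X x -> differentiable f x /\ forall v, 'd f x v = dotv (gradf x) v) ->
  0 <= L ->
  (forall x1 x2, X x1 -> X x2 -> enorm (gradf x1 - gradf x2) <= L * enorm (x1 - x2)) ->
  X x -> X z ->
  f x + dotv (gradf x) (z - x) <= f z.
Proof.
move=> cX cf hf L0 hL Xx Xz; rewrite -subr_le0.
apply: (@le0_of_quadratic _ _ (L * enorm (z - x) ^+ 2)) => t ht.
have [c /andP[c0 c1]] := @mvt_along_line _ _ X f gradf x z t 0 0 cX hf Xx Xz ht.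
rewrite !mulr0 !subr0 => e; have /andP[t0 t1] := ht.
have := @lipschitz_grad_line _ _ X gradf L x z c cX hL Xx Xz.
rewrite (ltW c0) (le_trans (ltW c1) t1) => /(_ isT); rewrite ler_norml => /andP[h _].
have : f (x + t *: (z - x)) <= t * f z + (1 - t) * f x.
  have -> : x + t *: (z - x) = t *: z + (1 - t) *: x.
    by apply/matrixP => i j; rewrite !mxE; ring.
  by apply: cf => //; rewrite ltW.
have H0 : 0 <= L * enorm (z - x) ^+ 2 by rewrite mulr_ge0 // sqr_ge0.
have : L * c * enorm (z - x) ^+ 2 <= t * (L * enorm (z - x) ^+ 2).
  by rewrite mulrAC mulrC ler_wpM2r // ltW.
move=> h1 h2.
have h3 : dotv (gradf x) (z - x) - dotv (gradf (x + c *: (z - x))) (z - x)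
   <= t * (L * enorm (z - x) ^+ 2) by lra.
have := ler_wpM2l (ltW t0) h3; rewrite mulrA -expr2; lra.
Qed.

(** * The one-step inequality and its summation along a sample path *)

Lemma young_le {R : realType} {n : nat} (u v : 'cV[R]_n) (c : R) : 0 < c ->
  dotv u v <= dotv u u / c + c / 4 * dotv v v.
Proof.
move=> c0; have := dotv_ge0 (u - (c / 2) *: v); rewrite !dotvE (dotvC v u) => h.
rewrite -(ler_pM2r c0) mulrDl divfK ?gt_eqF //; lra.
Qed.

Lemma coupling_le {R : realType} {l d : nat} (F : 'M[R]_(l, d)) (lam r : R)
  (e : 'cV[R]_l) (h : 'cV[R]_d) : is_lambda_max (F^T *m F) lam -> 0 < r ->
  dotv e (F *m h) <= lam * dotv e e / r + r / 4 * dotv h h.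
Proof.
move=> hlam r0.
have l0 := lambda_max_ge0 hlam.
have hF := opnorm_sqr_le h hlam.
(* Young's inequality is used below with parameter r / lam, which needs lam > 0; when lam = 0 the
   vector F h vanishes. *)
have [l00|l00] := eqVneq lam 0.
  move: hF; rewrite l00 !mul0r add0r => hF.
  have /eqP : dotv (F *m h) (F *m h) == 0 by rewrite eq_le hF dotv_ge0.
  move/eqP; rewrite dotv_eq0 => /eqP ->.
  by rewrite -(scale0r 0) dotvZr mul0r mulr_ge0 ?dotv_ge0 // divr_ge0 // ltW.
have lp : 0 < lam by rewrite lt_def l00 l0.
apply: le_trans (young_le _ _ (divr_gt0 r0 lp)) _.
rewrite invf_div mulrA [dotv e e * lam]mulrC lerD2l.
have -> : r / lam / 4 * dotv (F *m h) (F *m h) = r / 4 * (dotv (F *m h) (F *m h) / lam).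
  by field; rewrite gt_eqF.
apply: ler_wpM2l; first by rewrite divr_ge0 // ltW.
by rewrite ler_pdivrMr // mulrC.
Qed.

Lemma spdhg_step_gap {R : realType} {d l : nat} (X : set 'cV[R]_d) (Y : set 'cV[R]_l)
  (F : 'M[R]_(l, d)) (lam : R) (loss : 'cV[R]_d -> R) (gradl : 'cV[R]_d -> 'cV[R]_d)
  (L s r : R) (x x' g xs : 'cV[R]_d) (y y' ys : 'cV[R]_l) :
  convex_set_ X -> convex_set_ Y ->
  is_lambda_max (F^T *m F) lam ->
  convex_on X loss ->
  (forall x, X x -> differentiable loss x /\
                    forall v, 'd loss x v = dotv (gradl x) v) ->
  0 <= L ->
  (forall x1 x2, X x1 -> X x2 -> enorm (gradl x1 - gradl x2) <= L * enorm (x1 - x2)) ->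
  0 < s -> 0 < r -> X x -> X x' -> X xs -> Y y' -> Y ys ->
  (forall z, Y z -> enorm (y' - (y + s *: (F *m x))) <= enorm (z - (y + s *: (F *m x)))) ->
  (forall z, X z -> enorm (x' - (x - (r + L)^-1 *: (g + F^T *m y')))
                    <= enorm (z - (x - (r + L)^-1 *: (g + F^T *m y')))) ->
  Psad loss F ys x' - Psad loss F y' xs <=
    (r + L) / 2 * (enorm (x - xs) ^+ 2 - enorm (x' - xs) ^+ 2)
    + (2 * s)^-1 * (enorm (y - ys) ^+ 2 - enorm (y' - ys) ^+ 2)
    - dotv (g - gradl x) (x - xs)
    + (enorm (g - gradl x) ^+ 2 + lam * enorm (y' - ys) ^+ 2) / r.
Proof.
move=> cX cY hlam cf hf L0 hL s0 r0 Xx Xx' Xxs Yy' Yys hy hx.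
have hy1 := projection_variational cY Yy' hy Yys.
have hx1 := projection_variational cX Xx' hx Xxs.
have hd := descent_lemma cX hf hL Xx Xx'.
have hc := convex_grad_ineq cX cf hf L0 hL Xx Xxs.
have rL : 0 < r + L by rewrite ltr_pwDl.
(* Three-point identity for the dual projection; the term - |y - y'|^2 is dropped. *)
have hy2 : dotv (ys - y') (F *m x) <=
    (2 * s)^-1 * (dotv (y - ys) (y - ys) - dotv (y' - ys) (y' - ys)).
  have s2 : 0 < 2 * s by rewrite mulr_gt0.
  rewrite -(ler_pM2l s2) mulrA divff ?gt_eqF // mul1r.
  have := dotv_ge0 (y - y'); move: hy1; rewrite !dotvE (dotvC y y') (dotvC y ys) (dotvC y' ys).
  lra.
(* The same identity for the primal projection, but here - |x' - x|^2 is kept: its part L / 2 pays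
   for [hd], and the part r / 2 for the two terms r / 4 of [hD] and [hF]. *)
have hx2 : dotv (g + F^T *m y') (x' - xs) <= (r + L) / 2 *
    (dotv (x - xs) (x - xs) - dotv (x' - xs) (x' - xs) - dotv (x' - x) (x' - x)).
  move: hx1; set G := g + _.
  have -> : x - (r + L)^-1 *: G - x' = (r + L)^-1 *: ((r + L) *: (x - x') - G).
    by rewrite scalerBr scalerA mulVf ?gt_eqF // scale1r addrAC.
  rewrite dotvZr pmulr_rle0 ?invr_gt0 //.
  have [H ->] : exists H, G = H by eexists.
  rewrite !dotvE (dotvC x x') (dotvC x' xs) (dotvC x xs) (dotvC xs H) (dotvC x' H); lra.
have hD := young_le (- (g - gradl x)) (x' - x) r0.
have hF := coupling_le (ys - y') (x' - x) hlam r0.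
have -> : enorm (y' - ys) ^+ 2 = dotv (ys - y') (ys - y') by rewrite enormB enorm_sqr.
move: hd hy2 hx2 hD hF hc; rewrite !enorm_sqr /Psad (dotvDl g) dotv_trmx.
have -> : dotv (- (g - gradl x)) (- (g - gradl x)) = dotv (g - gradl x) (g - gradl x).
  by rewrite dotvNl dotvNr opprK.
rewrite -(opprB ys y') (dotvNl (ys - y')) (dotvNr (ys - y')) opprK.
rewrite [(_ + lam * _) / r]mulrDl.
move: (_ / r) (lam * _ / r) => q1 q2.
move=> hd hy2 hx2 hD hF hc.
(* The noise against x' - xs is split at [x]: the part along x' - x goes to [hD], and the part along
   x - xs stays in the bound, to cancel in expectation. *)
have e1 : dotv (gradl x) (x' - x) + dotv (g - gradl x) (x' - x) + dotv g (x - xs)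
   = dotv g (x' - xs) by rewrite !dotvE; ring.
have e2 : dotv (gradl x) (xs - x) = - dotv g (x - xs) + dotv (g - gradl x) (x - xs).
  by rewrite !dotvE; ring.
have e3 : dotv (ys - y') (F *m x) + dotv (ys - y') (F *m (x' - x))
    = dotv ys (F *m x') - dotv y' (F *m (x' - xs)) - dotv y' (F *m xs).
  by rewrite !mulmxBr !dotvE; ring.
move: hD; rewrite dotvNl => hD.
lra.
Qed.

Lemma beta_stepE {R : realType} (L : R) (k : nat) :
  beta_step L k = (Num.sqrt k.+1%:R + L)^-1.
Proof. by rewrite /beta_step mul1r. Qed.

(** Deterministic: [g] is an arbitrary sequence of gradient estimates, and the noise terms are left
    in the sum for the probabilistic part. *)
Lemma spdhg_gap_le {R : realType} {d l : nat} (X : set 'cV[R]_d) (Y : set 'cV[R]_l)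
  (Dx Dy : R) (F : 'M[R]_(l, d)) (lam : R) (loss : 'cV[R]_d -> R)
  (gradl : 'cV[R]_d -> 'cV[R]_d) (L s : R) (xk g : nat -> 'cV[R]_d)
  (yk : nat -> 'cV[R]_l) (ys : 'cV[R]_l) (xs : 'cV[R]_d) (t : nat) :
  convex_set_ X -> (forall x x', X x -> X x' -> enorm (x - x') <= Dx) ->
  convex_set_ Y -> (forall y y', Y y -> Y y' -> enorm (y - y') <= Dy) ->
  is_lambda_max (F^T *m F) lam ->
  convex_on X loss ->
  (forall x, X x -> differentiable loss x /\
                    forall v, 'd loss x v = dotv (gradl x) v) ->
  0 <= L ->
  (forall x1 x2, X x1 -> X x2 -> enorm (gradl x1 - gradl x2) <= L * enorm (x1 - x2)) ->
  0 < s -> (forall k, X (xk k)) -> (forall k, Y (yk k)) -> X xs -> Y ys ->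
  (forall k z, Y z -> enorm (yk k.+1 - (yk k + s *: (F *m xk k)))
                      <= enorm (z - (yk k + s *: (F *m xk k)))) ->
  (forall k z, X z -> enorm (xk k.+1 - (xk k - beta_step L k *: (g k + F^T *m yk k.+1)))
                      <= enorm (z - (xk k - beta_step L k *: (g k + F^T *m yk k.+1)))) ->
  Psad loss F ys (avg xk t) - Psad loss F (avg yk t) xs <=
    t.+1%:R^-1 * ((Num.sqrt t.+1%:R + L) / 2 * Dx ^+ 2 + (2 * s)^-1 * Dy ^+ 2
      + 2 * lam * Dy ^+ 2 * Num.sqrt t.+1%:R
      + \sum_(k < t.+1) (enorm (g k - gradl (xk k)) ^+ 2 / Num.sqrt k.+1%:R
                         - dotv (g k - gradl (xk k)) (xk k - xs))).
Proof.
move=> cX hDx cY hDy hlam cf hf L0 hL s0 Xk Yk Xxs Yys hy hx.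
have l0 := lambda_max_ge0 hlam.
have sq k : 0 < Num.sqrt k.+1%:R :> R by rewrite sqrtr_gt0.
have sqD (n : nat) (A : set 'cV[R]_n) (D : R) u v :
    (forall x x', A x -> A x' -> enorm (x - x') <= D) -> A u -> A v ->
    0 <= enorm (u - v) ^+ 2 <= D ^+ 2.
  move=> h Au Av; rewrite sqr_ge0 /= ler_pXn2r // ?nnegrE ?enorm_ge0 //; first exact: h.
  exact: le_trans (enorm_ge0 _) (h _ _ Au Av).
have step k := spdhg_step_gap (r := Num.sqrt k.+1%:R) (g := g k) cX cY hlam cf hf L0 hL s0 (sq k)
  (Xk k) (Xk k.+1) Xxs (Yk k.+1) Yys (hy k).
have {}step k : Psad loss F ys (xk k.+1) - Psad loss F (yk k.+1) xs <=
    (Num.sqrt k.+1%:R + L) / 2 * (enorm (xk k - xs) ^+ 2 - enorm (xk k.+1 - xs) ^+ 2)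
    + (2 * s)^-1 * (enorm (yk k - ys) ^+ 2 - enorm (yk k.+1 - ys) ^+ 2)
    + (lam * Dy ^+ 2 / Num.sqrt k.+1%:R
    + (enorm (g k - gradl (xk k)) ^+ 2 / Num.sqrt k.+1%:R
       - dotv (g k - gradl (xk k)) (xk k - xs))).
  have := step k; rewrite -beta_stepE => /(_ (hx k)) h; apply: le_trans h _.
  have : lam * enorm (yk k.+1 - ys) ^+ 2 / Num.sqrt k.+1%:R
      <= lam * Dy ^+ 2 / Num.sqrt k.+1%:R.
    rewrite ler_pM2r ?invr_gt0 // ler_wpM2l //.
    by have /andP[] := sqD _ _ _ _ _ hDy (Yk k.+1) Yys.
  rewrite mulrDl; lra.
(* [Psad] is convex in [x] and affine in [y], so only the loss calls for Jensen's inequality. *)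
have jensen : Psad loss F ys (avg xk t) - Psad loss F (avg yk t) xs <=
    t.+1%:R^-1 * \sum_(k < t.+1) (Psad loss F ys (xk k.+1) - Psad loss F (yk k.+1) xs).
  rewrite /Psad sumrB !big_split /= sumr_const card_ord.
  have := convex_on_avg cX cf (fun k => Xk k.+1) t.
  have -> : dotv ys (F *m avg xk t) = t.+1%:R^-1 * \sum_(k < t.+1) dotv ys (F *m xk k.+1).
    by rewrite /avg -scalemxAr dotvZr mulmx_sumr dotv_sumr.
  have -> : dotv (avg yk t) (F *m xs) = t.+1%:R^-1 * \sum_(k < t.+1) dotv (yk k.+1) (F *m xs).
    rewrite /avg dotvZl dotvC dotv_sumr.
    by congr (_ * _); apply: eq_bigr => k _; rewrite dotvC.
  have : t.+1%:R^-1 * (loss xs *+ t.+1) = loss xs.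
    by rewrite -[loss xs *+ _]mulr_natl mulrA mulVf ?mul1r // pnatr_eq0.
  move: (t.+1%:R^-1) (loss xs *+ t.+1) => c q; rewrite mulrBr !mulrDr => ->; lra.
apply: le_trans jensen _; rewrite ler_wpM2l ?invr_ge0 //.
apply: le_trans (ler_sum _ (fun (k : 'I_t.+1) _ => step k)) _.
rewrite big_split /= big_split /= big_split /= [leLHS]addrA lerD2r.
apply: lerD; [apply: lerD|].
- apply: (telescope_weighted (b := fun k => (Num.sqrt k.+1%:R + L) / 2)
    (a := fun k => enorm (xk k - xs) ^+ 2)) => k; last exact: sqD hDx _ _.
  have := ltW (sq k); have : Num.sqrt k.+1%:R <= Num.sqrt k.+2%:R :> R.
    by rewrite ler_sqrt // ler_nat.
  lra.
- apply: (telescope_weighted (b := fun k => (2 * s)^-1)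
    (a := fun k => enorm (yk k - ys) ^+ 2)) => k; last exact: sqD hDy _ _.
  by rewrite lexx invr_ge0 mulr_ge0 // ltW.
- rewrite -mulr_sumr.
  have -> : 2 * lam * Dy ^+ 2 * Num.sqrt t.+1%:R = lam * Dy ^+ 2 * (2 * Num.sqrt t.+1%:R).
    by ring.
  by apply: ler_wpM2l; [rewrite mulr_ge0 ?sqr_ge0|exact: sum_invsqrt_le].
Qed.

Lemma rate_constant_le {R : realType} (t : nat) (Dx Dy lam L s sigma : R) :
  0 < s ->
  t.+1%:R^-1 * ((Num.sqrt t.+1%:R + L) / 2 * Dx ^+ 2 + (2 * s)^-1 * Dy ^+ 2
      + 2 * lam * Dy ^+ 2 * Num.sqrt t.+1%:R + 2 * sigma ^+ 2 * Num.sqrt t.+1%:R)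
  <= Dy ^+ 2 / (2 * s * t.+1%:R) + L * Dx ^+ 2 / (2 * t.+1%:R)
     + (Dx ^+ 2 + 2 * lam * Dy ^+ 2 + 2 * sigma ^+ 2) / Num.sqrt t.+1%:R.
Proof.
move=> s0.
have r0 : 0 < Num.sqrt t.+1%:R :> R by rewrite sqrtr_gt0.
have rE : t.+1%:R = Num.sqrt t.+1%:R ^+ 2 :> R by rewrite sqr_sqrtr.
(* This is exactly the difference of the two sides: the telescoped distances contribute only half of
   the Dx^2 term in the stated rate. *)
have : 0 <= Dx ^+ 2 / (2 * Num.sqrt t.+1%:R).
  by rewrite divr_ge0 ?sqr_ge0 // mulr_ge0 // ltW.
move: r0 rE; move: (t.+1%:R : R) (Num.sqrt _) => T r r0 -> h.
rewrite -subr_ge0; apply: le_trans h _; rewrite le_eqVlt; apply/orP; left; apply/eqP.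
by field; rewrite !gt_eqF.
Qed.

(** * Measurability of the iterates *)

(** Continuity of [h] relative to the coordinates of [Z] makes the preimage of an open ray a
    countable union of preimages under [Z] of rational boxes. The modulus [del] may depend on the
    point. *)
Lemma measurable_fun_of_modulus {R : realType} {n : nat} {dT : measure_display}
  {T : measurableType dT} (Z : T -> 'cV[R]_n) (h : T -> R) :
  measurable_vec Z ->
  (forall w e, 0 < e -> exists2 del, 0 < del &
     forall w', (forall i, `|Z w' i 0 - Z w i 0| < del) -> `|h w' - h w| < e) ->
  measurable_fun setT h.
Proof.
move=> mZ hZ.
apply: (measurability _ (RGenOInfty.measurableE R)) => _ [_ [a ->] <-]; rewrite setTI.
pose box (q : {ffun 'I_n -> rat} * nat) : set T :=
  \bigcap_(i : 'I_n) (fun w => Z w i 0) @^-1` ball (ratr (q.1 i) : R) q.2.+1%:R^-1.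
have mbox q : measurable (box q).
  apply: fin_bigcap_measurable => // i _.
  by rewrite -[X in measurable X]setTI; apply: mZ => //; exact: measurable_ball.
have -> : h @^-1` `]a, +oo[ =
    \bigcup_q (if `[< box q `<=` h @^-1` `]a, +oo[ >] then box q else set0).
  apply/seteqP; split=> [w|w [q _]]; last by case: asboolP => // h1 h2; exact: h1.
  rewrite /= in_itv /= andbT => aw.
  have [del del0 hdel] := hZ w (h w - a) (ltac:(by rewrite subr_gt0)).
  (* Two points of a box of radius 1 / (m+1) differ by less than 2 / (m+1) in each coordinate. *)
  have [m hm] : exists m, 2 * m.+1%:R^-1 < del :> R.
    have [m _ /(_ _ (leqnn m))] := near_infty_natSinv_lt (PosNum (divr_gt0 del0 (ltr0n R 2))).
    by rewrite /= ltr_pdivlMr // mulrC; exists m.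
  have m0 : 0 < m.+1%:R^-1 :> R by rewrite invr_gt0.
  have hq i : exists q : rat, ball (Z w i 0) m.+1%:R^-1 (ratr q : R).
    have [q] := @rat_in_itvoo R (Z w i 0) (Z w i 0 + m.+1%:R^-1) (ltac:(by rewrite ltrDl)).
    rewrite in_itv /= => /andP[q1 q2]; exists q.
    by rewrite /ball /= distrC ger0_norm ?subr_ge0 ?ltW // ltrBlDl.
  have [q hq'] := choice hq.
  have bE w' : box (finfun q, m) w' <->
      forall i, `|ratr (q i) - Z w' i 0| < m.+1%:R^-1.
    split=> [b i|b i _]; first by have := b i I; rewrite /= /ball /= ffunE.
    by rewrite /= /ball /= ffunE.
  exists (finfun q, m) => //; case: asboolP => [_|].
    by apply/bE => i; rewrite distrC; exact: hq'.
  case=> w' /bE hw' /=; rewrite in_itv /= andbT.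
  have /hdel : forall i, `|Z w' i 0 - Z w i 0| < del.
    move=> i; apply: le_lt_trans hm.
    have := hw' i; have := hq' i; rewrite /ball /=.
    move: (m.+1%:R^-1 : R) (ratr (q i) : R) => c r.
    by rewrite !ltr_norml ler_norml => /andP[? ?] /andP[? ?]; apply/andP; split; lra.
  rewrite ltr_norml; lra.
apply: countable_bigcupT_measurable => [|q]; first exact: countableP.
by case: asboolP.
Qed.

Lemma measurable_vec_cst {R : realType} {n : nat} {dT : measure_display}
  {T : measurableType dT} (c : 'cV[R]_n) : measurable_vec (fun _ : T => c).
Proof. by move=> i; exact: measurable_cst. Qed.

Lemma measurable_vecD {R : realType} {n : nat} {dT : measure_display}
  {T : measurableType dT} (U V : T -> 'cV[R]_n) :
  measurable_vec U -> measurable_vec V -> measurable_vec (fun w => U w + V w).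
Proof.
by move=> mU mV i; under eq_fun do rewrite mxE; exact: measurable_funD.
Qed.

Lemma measurable_vecZ {R : realType} {n : nat} {dT : measure_display}
  {T : measurableType dT} (c : R) (U : T -> 'cV[R]_n) :
  measurable_vec U -> measurable_vec (fun w => c *: U w).
Proof.
by move=> mU i; under eq_fun do rewrite mxE; apply: measurable_funM => //; exact: measurable_cst.
Qed.

Lemma measurable_vecB {R : realType} {n : nat} {dT : measure_display}
  {T : measurableType dT} (U V : T -> 'cV[R]_n) :
  measurable_vec U -> measurable_vec V -> measurable_vec (fun w => U w - V w).
Proof.
move=> mU mV; apply: measurable_vecD => //.
by under eq_fun do rewrite -scaleN1r; exact: measurable_vecZ.
Qed.

Lemma measurable_vec_mulmx {R : realType} {m n : nat} {dT : measure_display}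
  {T : measurableType dT} (A : 'M[R]_(m, n)) (U : T -> 'cV[R]_n) :
  measurable_vec U -> measurable_vec (fun w => A *m U w).
Proof.
move=> mU i; under eq_fun do rewrite mxE.
by apply: measurable_sum => j; apply: measurable_funM => //; exact: measurable_cst.
Qed.

Lemma measurable_vec_avg {R : realType} {n : nat} {dT : measure_display}
  {T : measurableType dT} (U : nat -> T -> 'cV[R]_n) (t : nat) :
  (forall k, measurable_vec (U k)) -> measurable_vec (fun w => avg (fun k => U k w) t).
Proof.
move=> mU; apply: measurable_vecZ => i.
under eq_fun do rewrite summxE.
by apply: measurable_sum => j; exact: mU.
Qed.

Lemma measurable_dotv {R : realType} {n : nat} {dT : measure_display}
  {T : measurableType dT} (U V : T -> 'cV[R]_n) :
  measurable_vec U -> measurable_vec V -> measurable_fun setT (fun w => dotv (U w) (V w)).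
Proof.
by move=> mU mV; apply: measurable_sum => i; exact: measurable_funM.
Qed.

Lemma measurable_vec_of_lipschitz {R : realType} {m n : nat} {dT : measure_display}
  {T : measurableType dT} (Z : T -> 'cV[R]_n) (W : T -> 'cV[R]_m) (K : R) :
  0 <= K -> measurable_vec Z ->
  (forall w w', dotv (W w' - W w) (W w' - W w) <= K * dotv (Z w' - Z w) (Z w' - Z w)) ->
  measurable_vec W.
Proof.
move=> K0 mZ hW i; apply: measurable_fun_of_modulus mZ _ => w e e0.
have Kn : 0 <= K * n%:R by rewrite mulr_ge0.
have Kn1 : 0 < K * n%:R + 1 by rewrite ltr_wpDl.
(* [K] bounds squared distances, so with a = K n the squared variation is at most a del^2 < (a +
   1)^2 del^2 = e^2; the + 1 also covers a = 0. *)
exists (e / (K * n%:R + 1)); first by rewrite divr_gt0.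
move=> w' hw'; set del := e / _ in hw'.
have del0 : 0 < del by rewrite divr_gt0.
rewrite -(ltr_pXn2r (n := 2)) ?nnegrE ?(ltW e0) // real_normK ?num_real //.
have h1 : (W w' i 0 - W w i 0) ^+ 2 <= dotv (W w' - W w) (W w' - W w).
  rewrite /dotv (bigD1 i) //= !mxE expr2 lerDl sumr_ge0 // => j _.
  by rewrite !mxE -expr2 sqr_ge0.
have h2 : dotv (Z w' - Z w) (Z w' - Z w) <= n%:R * del ^+ 2.
  have -> : n%:R * del ^+ 2 = \sum_(j < n) del ^+ 2.
    by rewrite sumr_const card_ord mulr_natl.
  apply: ler_sum => j _; rewrite !mxE -expr2 -(real_normK (num_real (_ - _))).
  by rewrite ler_pXn2r ?nnegrE ?(ltW del0) // ltW.
apply: le_lt_trans (le_trans h1 (hW _ _)) _.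
apply: le_lt_trans (ler_wpM2l K0 h2) _.
have eE : e = del * (K * n%:R + 1) by rewrite /del divfK // gt_eqF.
rewrite mulrA eE; move: Kn; move: (K * n%:R) => a a0.
have := exprn_gt0 2 del0; move: (del ^+ 2) (exprMn 2 del (a + 1)) => b -> b0.
nra.
Qed.

(** Continuity is asked only at the values of [Z], as the loss is assumed differentiable only at the
    points of [X]. *)
Lemma measurable_comp_continuous {R : realType} {n : nat} {dT : measure_display}
  {T : measurableType dT} (f : 'cV[R]_n -> R) (Z : T -> 'cV[R]_n) :
  measurable_vec Z -> (forall w, {for Z w, continuous f}) ->
  measurable_fun setT (fun w => f (Z w)).
Proof.
move=> mZ hf; apply: measurable_fun_of_modulus mZ _ => w e e0.
have /cvgrPdist_lt/(_ _ e0) := hf w.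
move=> /nbhs_ballP[del /= del0 hdel]; exists del => // w' hw'.
rewrite distrC; apply: hdel; split=> // i j; rewrite ord1 /ball /= distrC; exact: hw'.
Qed.

(** Both updates are projections, hence 1-Lipschitz in the projected vector. [T] is arbitrary and
    only the samples 1 to [k] need be measurable, so the lemma applies to the ambient sigma-algebra
    as well as to that of the past. *)
Lemma measurable_spdhg_iterates {R : realType} {d l : nat} (X : set 'cV[R]_d)
  (Y : set 'cV[R]_l) (F : 'M[R]_(l, d)) (L s : R) {dX : measure_display}
  {Xi : measurableType dX} (G : 'cV[R]_d -> Xi -> 'cV[R]_d)
  {dT : measure_display} {T : measurableType dT} (xi : nat -> T -> Xi)
  (x0 : 'cV[R]_d) (y0 : 'cV[R]_l)
  (xk : nat -> T -> 'cV[R]_d) (yk : nat -> T -> 'cV[R]_l) (k : nat) :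
  convex_set_ X -> convex_set_ Y -> jointly_measurable G ->
  xk 0%N = (fun _ => x0) -> yk 0%N = (fun _ => y0) ->
  (forall k w, X (xk k.+1 w)) -> (forall k w, Y (yk k.+1 w)) ->
  (forall k w z, Y z -> enorm (yk k.+1 w - (yk k w + s *: (F *m xk k w)))
                        <= enorm (z - (yk k w + s *: (F *m xk k w)))) ->
  (forall k w z, X z ->
    enorm (xk k.+1 w - (xk k w - beta_step L k *:
                          (G (xk k w) (xi k.+1 w) + F^T *m yk k.+1 w)))
    <= enorm (z - (xk k w - beta_step L k *:
                          (G (xk k w) (xi k.+1 w) + F^T *m yk k.+1 w)))) ->
  (forall j, (0 < j <= k)%N -> measurable_fun setT (xi j)) ->
  measurable_vec (xk k) /\ measurable_vec (yk k).
Proof.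
move=> cX cY mG hx0 hy0 Xk Yk hy hx.
elim: k => [_|k IH mxi]; first by rewrite hx0 hy0; split; exact: measurable_vec_cst.
have [|mx my] := IH; first by move=> j /andP[j0 jk]; apply: mxi; rewrite j0 ltnW.
have my' : measurable_vec (yk k.+1).
  apply: (@measurable_vec_of_lipschitz _ _ _ _ _ (fun w => yk k w + s *: (F *m xk k w)) _ 1) => //.
    by apply: measurable_vecD => //; apply: measurable_vecZ; exact: measurable_vec_mulmx.
  by move=> w w'; rewrite mul1r; exact: (projection_nonexpansive cY (Yk _ _) (Yk _ _) (hy _ _) (hy _ _)).
split=> //.
apply: (@measurable_vec_of_lipschitz _ _ _ _ _ (fun w => xk k w - beta_step L k *:
    (G (xk k w) (xi k.+1 w) + F^T *m yk k.+1 w)) _ 1) => //.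
  apply: measurable_vecB => //; apply: measurable_vecZ; apply: measurable_vecD.
    by apply: mG => //; apply: mxi; rewrite /= leqnn.
  exact: measurable_vec_mulmx.
by move=> w w'; rewrite mul1r; exact: (projection_nonexpansive cX (Xk _ _) (Xk _ _) (hx _ _) (hx _ _)).
Qed.

(** * The past sigma-algebra and the next sample *)

(** The pi-system generating the sigma-algebra of the samples 1 to [k]; indices start at 1 because
    step [k] draws [xi k.+1]. *)
Definition past_cylinders {T Xi : Type} (mXi : set (set Xi)) (xi : nat -> T -> Xi)
  (k : nat) : set (set T) :=
  [set A | exists2 B : nat -> set Xi, (forall j, mXi (B j)) &
           A = \big[setI/setT]_(j <- iota 1 k) (xi j @^-1` B j)].

Local Notation pastType xi k := (g_sigma_algebraType (past_cylinders measurable xi k)).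

Lemma setI_closed_past_cylinders {dT dX : measure_display} {T : measurableType dT}
  {Xi : measurableType dX} (xi : nat -> T -> Xi) (k : nat) :
  setI_closed (past_cylinders measurable xi k).
Proof.
move=> _ _ [B mB ->] [C mC ->]; exists (fun j => B j `&` C j).
  by move=> j; exact: measurableI.
by rewrite -big_split.
Qed.

Lemma past_cylindersT {dT dX : measure_display} {T : measurableType dT}
  {Xi : measurableType dX} (xi : nat -> T -> Xi) (k : nat) :
  past_cylinders measurable xi k setT.
Proof. by exists (fun=> setT) => //; rewrite big1. Qed.

Lemma past_cylinders_measurable {dT dX : measure_display} {T : measurableType dT}
  {Xi : measurableType dX} (xi : nat -> T -> Xi) (k : nat) :
  (forall j, measurable_fun setT (xi j)) ->
  past_cylinders measurable xi k `<=` @measurable _ T.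
Proof.
move=> mxi _ [B mB ->]; apply: big_ind => // [A C|j _]; first exact: measurableI.
by rewrite -[X in measurable X]setTI; exact: mxi.
Qed.

Lemma measurable_past {dT dX : measure_display} {T : measurableType dT}
  {Xi : measurableType dX} (xi : nat -> T -> Xi) (k j : nat) :
  (0 < j <= k)%N -> measurable_fun setT (xi j : pastType xi k -> Xi).
Proof.
move=> jk _ C mC; rewrite setTI; apply: sub_sigma_algebra.
exists (fun i => if i == j then C else setT); first by move=> i; case: eqP.
rewrite (bigD1_seq j) ?iota_uniq //=; last by rewrite mem_iota add1n ltnS.
by rewrite eqxx big1 ?setIT // => i /negbTE ->.
Qed.

Lemma measurable_to_past {dT dX : measure_display} {T : measurableType dT}
  {Xi : measurableType dX} (xi : nat -> T -> Xi) (k : nat) :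
  (forall j, measurable_fun setT (xi j)) ->
  measurable_fun setT (id : T -> pastType xi k).
Proof.
move=> mxi _ A mA; rewrite setTI preimage_id.
by apply: (smallest_sub (sigma_algebra_measurable T) (past_cylinders_measurable mxi)) mA.
Qed.

(** For fixed [B], both sides are finite measures in [A]; they agree on the cylinders by mutual
    independence, hence on the sigma-algebra these generate. *)
Lemma past_future_independent {R : realType} {dT dX : measure_display}
  {T : measurableType dT} {Xi : measurableType dX} (P : probability T R)
  (xi : nat -> T -> Xi) (mu : probability Xi R) (k : nat) (A : set (pastType xi k))
  (B : set Xi) :
  mutually_independent P xi -> identically_distributed P xi mu ->
  measurable A -> measurable B ->
  P (A `&` xi k.+1 @^-1` B) = (P A * mu B)%E.
Proof.
move=> [mxi ind] idd mA mB.
have mC : measurable (xi k.+1 @^-1` B).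
  by rewrite -[X in measurable X]setTI; exact: mxi.
have muBE : mu B = (fine (mu B))%:E by rewrite fineK // fin_num_measure.
pose r := NngNum (fine_ge0 (measure_ge0 mu B)).
rewrite muBE muleC.
apply: (@g_sigma_algebra_measure_unique _ R T (past_cylinders measurable xi k)
  (past_cylinders_measurable mxi) (fun=> setT) (fun=> past_cylindersT xi k) _
  (mrestr P mC) (mscale r P) (@setI_closed_past_cylinders _ _ _ _ xi k)) => //.
- by rewrite bigcup_const //; exists 0%N.
- move=> _ [D mD ->]; set S := \big[_/_]_(_ <- _) _.
  change (P (S `&` xi k.+1 @^-1` B) = ((fine (mu B))%:E * P S)%E).
  rewrite -muBE setIC {}/S.
  (* [B] is spliced in at index k + 1, so that independence applies to a single family over
     [k.+1 :: iota 1 k]. *)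
  pose D' j := if j == k.+1 then B else D j.
  have D'E j : j \in iota 1 k -> D' j = D j.
    by rewrite mem_iota add1n ltnS /D' => /andP[_ jk]; rewrite ltn_eqF.
  have bigE : \big[setI/setT]_(j <- iota 1 k) (xi j @^-1` D j) =
              \big[setI/setT]_(j <- iota 1 k) (xi j @^-1` D' j).
    by apply: eq_big_seq => j /D'E ->.
  have D'k : D' k.+1 = B by rewrite /D' eqxx.
  have mD' j : measurable (D' j) by rewrite /D'; case: eqP.
  have uk : uniq (k.+1 :: iota 1 k).
    by rewrite /= mem_iota add1n ltnS ltnn andbF iota_uniq.
  have := ind (k.+1 :: iota 1 k) D' uk mD'.
  by rewrite !big_cons D'k -ind ?iota_uniq // -bigE idd.
- move=> j; change (P (setT `&` xi k.+1 @^-1` B) < +oo)%E; rewrite setTI.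
  exact: (le_lt_trans (probability_le1 P mC) (ltry 1)).
Qed.

(** [P'] is [P] restricted to the past, obtained as the law of the identity map into [pastType].
    Agreement on rectangles identifies the joint law [J] with the product. *)
Lemma past_future_law {R : realType} {dT dX : measure_display}
  {T : measurableType dT} {Xi : measurableType dX} (P : probability T R)
  (xi : nat -> T -> Xi) (mu : probability Xi R) (k : nat) :
  mutually_independent P xi -> identically_distributed P xi mu ->
  exists P' : probability (pastType xi k) R,
  exists2 J : {measure set (pastType xi k * Xi) -> \bar R},
    J = pushforward P (fun w => (w, xi k.+1 w)) :> (set _ -> _) &
    forall A, measurable A -> (P' \x mu)%E A = J A.
Proof.
move=> ind idd; have mxi := ind.1.
have mid := measurable_to_past (k := k) mxi.
have mpair : measurable_fun setT (fun w : T => ((w : pastType xi k), xi k.+1 w)).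
  exact: measurable_fun_pair.
pose P' : probability (pastType xi k) R := distribution P (mfun_Sub (mem_set mid)).
pose J : {measure set (pastType xi k * Xi) -> \bar R} :=
  distribution P (mfun_Sub (mem_set mpair)).
exists P', J; first by [].
apply: (@product_measure_unique _ _ _ _ _ P' mu J) => A B mA mB.
exact (past_future_independent ind idd mA mB).
Qed.

(** Tonelli on the product law: a bound valid for each frozen past survives averaging over the past.
    It stands in for a conditional expectation. *)
Lemma ge0_integral_past_future_le {R : realType} {dT dX : measure_display}
  {T : measurableType dT} {Xi : measurableType dX} (P : probability T R)
  (xi : nat -> T -> Xi) (mu : probability Xi R) (k : nat)
  (f : pastType xi k * Xi -> \bar R) (c : R) :
  mutually_independent P xi -> identically_distributed P xi mu ->
  measurable_fun setT f -> (forall z, 0 <= f z)%E ->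
  (forall w, \int[mu]_z f (w, z) <= c%:E)%E ->
  (\int[P]_w f (w, xi k.+1 w) <= c%:E)%E.
Proof.
move=> ind idd mf f0 hc; have mxi := ind.1.
have [P' [J JE PJ]] := past_future_law k ind idd.
have mpair : measurable_fun setT (fun w : T => ((w : pastType xi k), xi k.+1 w)).
  by apply: measurable_fun_pair => //; exact: measurable_to_past.
have -> : (\int[P]_w f (w, xi k.+1 w) = \int[P' \x mu]_z f z)%E.
  transitivity (\int[J]_z f z)%E; last first.
    by apply: eq_measure_integral => A mA _; exact: (esym (PJ A mA)).
  by rewrite JE (ge0_integral_pushforward mpair).
rewrite fubini_tonelli1 // /fubini_F.
apply: (@le_trans _ _ (\int[P']_w c%:E)%E).
  apply: ge0_le_integral => //.
  - by move=> w _; exact: integral_ge0.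
  - exact: measurable_fun_fubini_tonelli_F.
rewrite integral_cst // [X in (_ * X)%E](_ : _ = 1%E) ?mule1 //.
exact: probability_setT.
Qed.

(** The signed counterpart, by Fubini; integrability under [P] is carried to the product measure
    through [J]. *)
Lemma integral_past_future_eq0 {R : realType} {dT dX : measure_display}
  {T : measurableType dT} {Xi : measurableType dX} (P : probability T R)
  (xi : nat -> T -> Xi) (mu : probability Xi R) (k : nat)
  (f : pastType xi k * Xi -> \bar R) :
  mutually_independent P xi -> identically_distributed P xi mu ->
  measurable_fun setT f -> P.-integrable setT (fun w => f (w, xi k.+1 w)) ->
  (forall w, \int[mu]_z f (w, z) = 0)%E ->
  (\int[P]_w f (w, xi k.+1 w) = 0)%E.
Proof.
move=> ind idd mf intf h0; have mxi := ind.1.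
have [P' [J JE PJ]] := past_future_law k ind idd.
have mpair : measurable_fun setT (fun w : T => ((w : pastType xi k), xi k.+1 w)).
  by apply: measurable_fun_pair => //; exact: measurable_to_past.
have intJ : J.-integrable setT f.
  by rewrite JE; apply: (integrable_pushforward mpair).
have -> : (\int[P]_w f (w, xi k.+1 w) = \int[P' \x mu]_z f z)%E.
  transitivity (\int[J]_z f z)%E; last first.
    by apply: eq_measure_integral => A mA _; exact: (esym (PJ A mA)).
  by rewrite JE (integral_pushforward mpair).
rewrite -integral12_prod_meas1 /fubini_F; last first.
  apply/integrableP; split=> //; have /integrableP[_] := intJ.
  rewrite (@eq_measure_integral _ _ _ _ (P' \x mu)%E J) // => A mA _.
  exact: (esym (PJ A mA)).
by rewrite (eq_integral (cst 0%E)) ?integral0 // => w _; rewrite h0.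
Qed.

(** * Moments of the gradient noise *)

(** Integrability is bundled with the value so that the linearity rules compose without side
    conditions. *)
Definition has_mean {R : realType} {dT : measure_display} {T : measurableType dT}
  (P : probability T R) (f : T -> R) (m : R) : Prop :=
  P.-integrable setT (fun w => (f w)%:E) /\ (\int[P]_w (f w)%:E = m%:E)%E.

Lemma has_mean_cst {R : realType} {dT : measure_display} {T : measurableType dT}
  (P : probability T R) (c : R) : has_mean P (fun=> c) c.
Proof.
split; first exact: finite_measure_integrable_cst.
rewrite (integral_cst P measurableT) [X in (_ * X)%E](_ : _ = 1%E) ?mule1 //.
exact: probability_setT.
Qed.

Lemma has_meanD {R : realType} {dT : measure_display} {T : measurableType dT}
  (P : probability T R) (f g : T -> R) (a b : R) :
  has_mean P f a -> has_mean P g b -> has_mean P (fun w => f w + g w) (a + b).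
Proof.
move=> [If Ef] [Ig Eg]; split.
  exact: (integrableD measurableT If Ig).
under eq_integral do rewrite EFinD.
by rewrite integralD // Ef Eg.
Qed.

Lemma has_meanZ {R : realType} {dT : measure_display} {T : measurableType dT}
  (P : probability T R) (f : T -> R) (c a : R) :
  has_mean P f a -> has_mean P (fun w => c * f w) (c * a).
Proof.
move=> [If Ef]; split.
  exact: (integrableZl measurableT c If).
under eq_integral do rewrite EFinM.
by rewrite integralZl // Ef.
Qed.

Lemma has_mean_sum {R : realType} {dT : measure_display} {T : measurableType dT}
  (P : probability T R) (I : Type) (r : seq I) (f : I -> T -> R) (a : I -> R) :
  (forall i, has_mean P (f i) (a i)) ->
  has_mean P (fun w => \sum_(i <- r) f i w) (\sum_(i <- r) a i).
Proof.
move=> h; elim: r => [|i r IH].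
  by under eq_fun do rewrite big_nil; rewrite big_nil; exact: has_mean_cst.
by under eq_fun do rewrite big_cons; rewrite big_cons; exact: has_meanD.
Qed.

Lemma has_mean_le {R : realType} {dT : measure_display} {T : measurableType dT}
  (P : probability T R) (f : T -> R) (c : R) :
  measurable_fun setT f -> (forall w, 0 <= f w) -> (\int[P]_w (f w)%:E <= c%:E)%E ->
  exists2 m, has_mean P f m & m <= c.
Proof.
move=> mf f0 hc.
have I0 : (0 <= \int[P]_w (f w)%:E)%E by apply: integral_ge0 => w _; rewrite lee_fin.
have fn : (\int[P]_w (f w)%:E)%E \is a fin_num.
  by rewrite ge0_fin_numE //; exact: le_lt_trans hc (ltry _).
exists (fine (\int[P]_w (f w)%:E)%E); last by rewrite -lee_fin fineK.
split; last by rewrite fineK.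
apply/integrableP; split; first exact/measurable_EFinP.
under eq_integral do rewrite gee0_abs ?lee_fin //.
exact: le_lt_trans hc (ltry _).
Qed.

(** With the past frozen, [x w] is a fixed point of [X], where the variance bound and unbiasedness
    of [G] hold under [mu]; the product law transfers both to [P]. *)
Lemma gradient_noise {R : realType} {d : nat} (X : set 'cV[R]_d) (Dx : R)
  (gradl : 'cV[R]_d -> 'cV[R]_d) (L : R)
  {dX : measure_display} {Xi : measurableType dX} (mu : probability Xi R)
  (G : 'cV[R]_d -> Xi -> 'cV[R]_d) (sigma : R)
  {dT : measure_display} {T : measurableType dT} (P : probability T R)
  (xi : nat -> T -> Xi) (k : nat) (x : T -> 'cV[R]_d) (xs : 'cV[R]_d) :
  (forall x x', X x -> X x' -> enorm (x - x') <= Dx) ->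
  (forall x1 x2, X x1 -> X x2 -> enorm (gradl x1 - gradl x2) <= L * enorm (x1 - x2)) ->
  jointly_measurable G ->
  (forall x, X x -> forall i, has_mean mu (fun z => G x z i ord0) (gradl x i ord0)) ->
  (forall x, X x -> (\int[mu]_z (enorm (G x z - gradl x) ^+ 2)%:E <= (sigma ^+ 2)%:E)%E) ->
  mutually_independent P xi -> identically_distributed P xi mu ->
  measurable_vec (x : pastType xi k -> 'cV[R]_d) -> (forall w, X (x w)) -> X xs ->
  (exists2 m, has_mean P (fun w => enorm (G (x w) (xi k.+1 w) - gradl (x w)) ^+ 2) m
     & m <= sigma ^+ 2) /\
  has_mean P (fun w => dotv (G (x w) (xi k.+1 w) - gradl (x w)) (x w - xs)) 0.
Proof.
move=> hDx hL mG meanG varG ind idd mx Xx Xxs; have mxi := ind.1.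
pose D (p : pastType xi k * Xi) := G (x p.1) p.2 - gradl (x p.1).
have mx1 : measurable_vec (fun p : pastType xi k * Xi => x p.1).
  by move=> i; apply: measurableT_comp (mx i) _; exact: measurable_fst.
have mD : measurable_vec D.
  apply: measurable_vecB; first by apply: mG => //; exact: measurable_snd.
  apply: (measurable_vec_of_lipschitz (sqr_ge0 L) mx1) => p q.
  rewrite -!enorm_sqr -exprMn ler_pXn2r ?nnegrE ?enorm_ge0 //; first exact: hL.
  exact: le_trans (enorm_ge0 _) (hL _ _ (Xx _) (Xx _)).
have mpair : measurable_fun setT (fun w : T => ((w : pastType xi k), xi k.+1 w)).
  by apply: measurable_fun_pair => //; exact: measurable_to_past.
have mDsq : measurable_fun setT (fun p => enorm (D p) ^+ 2).
  by under eq_fun do rewrite enorm_sqr; exact: measurable_dotv.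
have mDd : measurable_fun setT (fun p => dotv (D p) (x p.1 - xs)).
  by apply: measurable_dotv => //; apply: measurable_vecB => //; exact: measurable_vec_cst.
have [m hm mle] : exists2 m, has_mean P (fun w => enorm (D (w, xi k.+1 w)) ^+ 2) m
     & m <= sigma ^+ 2.
  apply: has_mean_le.
  - exact: (measurableT_comp mDsq mpair).
  - by move=> w; exact: sqr_ge0.
  - apply: (@ge0_integral_past_future_le _ _ _ _ _ P xi mu k
      (fun p => (enorm (D p) ^+ 2)%:E)) => //.
    + exact/measurable_EFinP.
    + by move=> p; rewrite lee_fin sqr_ge0.
    + move=> w; rewrite /D /=; exact: (varG (x w) (Xx w)).
split; first by exists m.
(* Fubini needs integrability first: |<u, v>| <= |u| Dx <= |u|^2 + Dx^2, which has a finite mean. *)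
have intd : P.-integrable setT (fun w => (dotv (D (w, xi k.+1 w)) (x w - xs))%:E).
  have [intg _] := has_meanD hm (has_mean_cst P (Dx ^+ 2)).
  apply: le_integrable intg => //.
    apply/measurable_EFinP; exact: (measurableT_comp mDd mpair).
  move=> w _; rewrite !abse_EFin lee_fin.
  set u := D _; set v := x w - xs.
  have K (z : 'cV[R]_d) : enorm z = enorm u -> dotv z v <= enorm u ^+ 2 + Dx ^+ 2.
    move=> zu; apply: le_trans (dotv_le_enormM z v) _; rewrite zu.
    have := ler_wpM2l (enorm_ge0 u) (hDx _ _ (Xx w) Xxs); rewrite -/v.
    have := sqr_ge0 (enorm u - Dx); have := sqr_ge0 (enorm u); have := sqr_ge0 Dx.
    move: (enorm u) (enorm v) => a b; rewrite sqrrB; lra.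
  rewrite [leRHS]ger0_norm ?addr_ge0 ?sqr_ge0 // ler_norml K // andbT lerNl -dotvNl K //.
  by rewrite /enorm dotvNl dotvNr opprK.
split=> //.
apply: (@integral_past_future_eq0 _ _ _ _ _ P xi mu k
  (fun p => (dotv (D p) (x p.1 - xs))%:E)) => //; first exact/measurable_EFinP.
move=> w /=; set c := x w - xs.
suff : has_mean mu (fun z => dotv (D (w, z)) c) 0 by case.
(* The inner product is expanded because unbiasedness is given coordinate by coordinate. *)
have -> : 0 = \sum_(i < d) c i 0 * (gradl (x w) i 0 + - gradl (x w) i 0).
  by rewrite big1 // => i _; rewrite subrr mulr0.
have -> : (fun z => dotv (D (w, z)) c) =
    (fun z => \sum_(i < d) c i 0 * (G (x w) z i 0 + - gradl (x w) i 0)).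
  by apply/funext => z; apply: eq_bigr => i _; rewrite /D !mxE mulrC.
apply: has_mean_sum => i; apply: has_meanZ; apply: has_meanD; last exact: has_mean_cst.
exact: meanG.
Qed.

(** * From the pathwise bound to its expectation *)

Theorem theorem1 (R : realType) (d l : nat)
  (X : set 'cV[R]_d) (Y : set 'cV[R]_l) (Dx Dy : R)
  (F : 'M[R]_(l, d)) (lam : R)
  (loss : 'cV[R]_d -> R) (gradl : 'cV[R]_d -> 'cV[R]_d) (L : R)
  (dX : measure_display) (Xi : measurableType dX) (mu : probability Xi R)
  (G : 'cV[R]_d -> Xi -> 'cV[R]_d) (sigma : R)
  (dT : measure_display) (T : measurableType dT) (P : probability T R)
  (xi : nat -> T -> Xi) (s : R) (x0 : 'cV[R]_d) (y0 : 'cV[R]_l)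
  (xk : nat -> T -> 'cV[R]_d) (yk : nat -> T -> 'cV[R]_l)
  (ys : 'cV[R]_l) (xs : 'cV[R]_d) :
  (* the feasible sets *)
  X !=set0 -> convex_set_ X -> compact X ->
  (forall x x', X x -> X x' -> enorm (x - x') <= Dx) ->
  Y !=set0 -> convex_set_ Y -> compact Y ->
  (forall y y', Y y -> Y y' -> enorm (y - y') <= Dy) ->
  (* lam = lambda_max(F^T F) *)
  is_lambda_max (F^T *m F) lam ->
  (* the loss *)
  convex_on X loss ->
  (forall x, X x -> differentiable loss x /\
                    forall v, 'd loss x v = dotv (gradl x) v) ->
  {within X, continuous gradl} ->
  0 <= L ->
  (forall x1 x2, X x1 -> X x2 -> enorm (gradl x1 - gradl x2) <= L * enorm (x1 - x2)) ->
  (* the stochastic gradient *)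
  0 < sigma ->
  jointly_measurable G ->
  (forall x, X x ->
     (forall i, mu.-integrable setT (fun z => (G x z i ord0)%:E) /\
                ('E_mu[(fun z => G x z i ord0)] = (gradl x i ord0)%:E)%E) /\
     ('E_mu[(fun z => (enorm (G x z - gradl x) ^+ 2)%R)] <= (sigma ^+ 2)%R%:E)%E /\
     ('E_mu[(fun z => (expR (enorm (G x z - gradl x) ^+ 2 / sigma ^+ 2))%R)]
        <= (expR 1)%:E)%E) ->
  (* i.i.d. samples with law mu *)
  mutually_independent P xi -> identically_distributed P xi mu ->
  (* SPDHG iterates *)
  0 < s -> X x0 -> Y y0 ->
  xk 0%N = (fun _ => x0) -> yk 0%N = (fun _ => y0) ->
  (forall k w, Y (yk k.+1 w) /\
     forall y, Y y ->
       Psad loss F y (xk k w) - (2 * s)^-1 * enorm (y - yk k w) ^+ 2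
       <= Psad loss F (yk k.+1 w) (xk k w)
          - (2 * s)^-1 * enorm (yk k.+1 w - yk k w) ^+ 2) ->
  (forall k w,
     let v := xk k w - beta_step L k *:
                (G (xk k w) (xi k.+1 w) + F^T *m yk k.+1 w) in
     X (xk k.+1 w) /\ forall z, X z -> enorm (xk k.+1 w - v) <= enorm (z - v)) ->
  (* (ys, xs) is a saddle point *)
  Y ys -> X xs ->
  (forall y x, Y y -> X x ->
     Psad loss F y xs <= Psad loss F ys xs <= Psad loss F ys x) ->
  forall t : nat,
    (0 <= 'E_P[(fun w => (Psad loss F ys (avg (fun k => xk k w) t)
                        - Psad loss F (avg (fun k => yk k w) t) xs)%R)])%E /\
    ('E_P[(fun w => (Psad loss F ys (avg (fun k => xk k w) t)
                   - Psad loss F (avg (fun k => yk k w) t) xs)%R)]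
     <= ((Dy ^+ 2 / (2 * s * t.+1%:R) + L * Dx ^+ 2 / (2 * t.+1%:R)
         + (Dx ^+ 2 + 2 * lam * Dy ^+ 2 + 2 * sigma ^+ 2) / Num.sqrt t.+1%:R)%R%:E))%E.
Proof.
move=> _ cX _ hDx _ cY _ hDy hlam cf hf _ L0 hL _ mG hG ind idd s0 Xx0 Yy0 hx0 hy0 hy hx
  Yys Xxs saddle t.
have Xk k w : X (xk k w) by case: k => [|k]; [rewrite hx0|case: (hx k w)].
have Yk k w : Y (yk k w) by case: k => [|k]; [rewrite hy0|case: (hy k w)].
have hyp k w z : Y z -> enorm (yk k.+1 w - (yk k w + s *: (F *m xk k w)))
                      <= enorm (z - (yk k w + s *: (F *m xk k w))).
  by move=> Yz; apply: (prox_argmax_projection (loss := loss)) => //; exact: (hy k w).2.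
have hxp k w z : X z ->
    enorm (xk k.+1 w - (xk k w - beta_step L k *:
                          (G (xk k w) (xi k.+1 w) + F^T *m yk k.+1 w)))
    <= enorm (z - (xk k w - beta_step L k *:
                          (G (xk k w) (xi k.+1 w) + F^T *m yk k.+1 w))).
  exact: (hx k w).2.
have mxi := ind.1.
have mxyk k : measurable_vec (xk k) /\ measurable_vec (yk k).
  exact: (measurable_spdhg_iterates (k := k) cX cY mG hx0 hy0 (fun k => Xk k.+1)
    (fun k => Yk k.+1) hyp hxp (fun j _ => mxi j)).
(* The same induction over the past sigma-algebra: [xk k] depends only on the samples 1 to [k]. *)
have mpast k : measurable_vec (xk k : pastType xi k -> _).
  exact: (measurable_spdhg_iterates (T := pastType xi k) (k := k) cX cY mG hx0 hy0
    (fun k => Xk k.+1) (fun k => Yk k.+1) hyp hxp (fun j => @measurable_past _ _ _ _ xi k j)).1.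
have meanG x : X x -> forall i, has_mean mu (fun z => G x z i ord0) (gradl x i ord0).
  by move=> /hG[h _] i; have [h1] := h i; rewrite unlock.
have varG x : X x -> (\int[mu]_z (enorm (G x z - gradl x) ^+ 2)%:E <= (sigma ^+ 2)%:E)%E.
  by move=> /hG[_ [h _]]; move: h; rewrite unlock.
have noise k := gradient_noise hDx hL mG meanG varG ind idd (mpast k) (Xk k) Xxs.
(* The noise second moments are collected into one sequence [m], each at most sigma^2. *)
have [m /all_and2[hm mle]] := choice (fun k => let: conj (ex_intro2 m h1 h2) _ := noise k in
  ex_intro (fun m => _ /\ _) m (conj h1 h2)).
have hd k := (noise k).2.
have Xa w : X (avg (xk^~ w) t) by apply: convex_set_avg.
(* The saddle inequalities chain through P(ys, xs) for every outcome. This gives the lower bound and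
   lets the upper one use monotonicity of nonnegative integrals. *)
have gap_ge0 w : 0 <= Psad loss F ys (avg (xk^~ w) t) - Psad loss F (avg (yk^~ w) t) xs.
  have Ya : Y (avg (yk^~ w) t) by apply: convex_set_avg.
  by have /andP[h1 h2] := saddle _ _ Ya (Xa w); rewrite subr_ge0 (le_trans h1).
rewrite unlock; split; first by apply: integral_ge0 => w _; rewrite lee_fin.
pose A k w := (Num.sqrt k.+1%:R)^-1 * enorm (G (xk k w) (xi k.+1 w) - gradl (xk k w)) ^+ 2
  + -1 * dotv (G (xk k w) (xi k.+1 w) - gradl (xk k w)) (xk k w - xs).
pose C : R := (Num.sqrt t.+1%:R + L) / 2 * Dx ^+ 2 + (2 * s)^-1 * Dy ^+ 2
      + 2 * lam * Dy ^+ 2 * Num.sqrt t.+1%:R.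
(* The pathwise majorant has a computable mean, in which the cross terms contribute -1 * 0. *)
have [intH EH] : has_mean P (fun w => t.+1%:R^-1 * (C + \sum_(k < t.+1) A k w))
    (t.+1%:R^-1 * (C + \sum_(k < t.+1) ((Num.sqrt k.+1%:R)^-1 * m k + -1 * 0))).
  apply: has_meanZ; apply: has_meanD; first exact: has_mean_cst.
  by apply: has_mean_sum => k; apply: has_meanD; apply: has_meanZ.
have mloss : measurable_fun setT (fun w => loss (avg (xk^~ w) t)).
  apply: measurable_comp_continuous; first by apply: measurable_vec_avg => k; exact: (mxyk k).1.
  move=> w; apply: differentiable_continuous.
  by have [] := hf _ (Xa w).
apply: (@le_trans _ _ (\int[P]_w (t.+1%:R^-1 * (C + \sum_(k < t.+1) A k w))%:E)%E).
  apply: ge0_le_integral => //.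
  - by move=> w _; rewrite lee_fin.
  - apply/measurable_EFinP; rewrite /Psad; apply: measurable_funB.
      apply: measurable_funD => //; apply: measurable_dotv; first exact: measurable_vec_cst.
      by apply: measurable_vec_mulmx; apply: measurable_vec_avg => k; exact: (mxyk k).1.
    apply: measurable_funD; first exact: measurable_cst.
    apply: measurable_dotv; last exact: measurable_vec_cst.
    by apply: measurable_vec_avg => k; exact: (mxyk k).2.
  - by case/integrableP: intH.
  - move=> w _; rewrite lee_fin.
    have := spdhg_gap_le (g := fun k => G (xk k w) (xi k.+1 w)) t cX hDx cY hDy hlam cf hf L0 hL s0
      (Xk^~ w) (Yk^~ w) Xxs Yys (hyp^~ w) (hxp^~ w).
    congr (_ <= _ * (_ + _)); apply: eq_bigr => k _.
    by rewrite /A mulN1r [in RHS]mulrC.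
rewrite EH lee_fin; apply: le_trans (rate_constant_le _ _ _ _ _ sigma s0).
rewrite ler_wpM2l ?invr_ge0 // lerD2l.
under eq_bigr do rewrite mulr0 addr0.
have -> : 2 * sigma ^+ 2 * Num.sqrt t.+1%:R = sigma ^+ 2 * (2 * Num.sqrt t.+1%:R) by ring.
apply: le_trans (ler_wpM2l (sqr_ge0 sigma) (sum_invsqrt_le t.+1)).
rewrite mulr_sumr; apply: ler_sum => k _.
by rewrite mulrC ler_wpM2r // invr_ge0 sqrtr_ge0.
Qed.
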